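(* For all nonnegative integers $n$, $p$ and every complex number $m$: $$\sum_{k=0}^n k^p H_k^{(m)} = H_n^{(-p)} H_n^{(m)} + H_n^{(m-p)} - \frac{1}{p+1} \sum_{k=1}^{p+1} \binom{p+1}{k} B_{p-k+1}^+ H_n^{(m-k)}.$$
   Context: For a nonnegative integer $n$ and a complex number $m$, the generalized harmonic number is $H_n^{(m)} = \sum_{k=1}^n \frac{1}{k^m}$, where $k^m = e^{m\ln k}$ with the real logarithm for positive integers $k$. In particular $H_0^{(m)} = 0$ (empty sum), and $H_n^{(-p)} = \sum_{k=1}^n k^p$ for nonnegative integers $p$. The numbers $B_j^+$ ($j\ge 0$) are the Bernoulli numbers with the convention $B_1^+ = 1/2$, that is, $B_j^+ = (-1)^j B_j = B_j + \delta_{j,1}$, where $B_j$ are the Bernoulli numbers with $B_1=-1/2$ and $\delta$ is the Kronecker delta. The convention $0^0=1$ is used. *)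

(* Defs.v *)
From mathcomp Require Import all_boot all_order all_algebra.
From mathcomp Require Import reals sequences exp trigo.
From mathcomp Require Import complex.

Set Implicit Arguments.
Unset Strict Implicit.
Unset Printing Implicit Defensive.

Import Order.TTheory GRing.Theory Num.Theory.
Local Open Scope ring_scope.
Local Open Scope complex_scope.

Definition cexp (R : realType) (z : R[i]) : R[i] :=
  (expR (complex.Re z))%:C * (cos (complex.Im z) +i* sin (complex.Im z)).

(* [k ^ m] for a complex exponent [m]; meaningful for [k > 0] only. *)
Definition ncpow (R : realType) (k : nat) (m : R[i]) : R[i] :=
  cexp (m * (ln (k%:R : R))%:C).

Definition gen_harmonic (R : realType) (n : nat) (m : R[i]) : R[i] :=
  \sum_(1 <= k < n.+1) (ncpow k m)^-1.

(* [:: B_0; ...; B_(n-1)], built from the recurrence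
   B_n = - 1 / (n + 1) * \sum_(k < n) 'C(n + 1, k) B_k  (n > 0),  B_0 = 1. *)
Fixpoint bernoulli_seq (n : nat) : seq rat :=
  if n is n'.+1 then
    let s := bernoulli_seq n' in
    rcons s (if n' == 0%N then 1
             else - (n'.+1%:R)^-1 * \sum_(k < n') 'C(n'.+1, k)%:R * s`_k)
  else [::].

Definition bernoulli_num (j : nat) : rat := (bernoulli_seq j.+1)`_j.

Definition bernoulli_plus (j : nat) : rat := (-1) ^+ j * bernoulli_num j.

Lemma size_bernoulli_seq n : size (bernoulli_seq n) = n.
Proof. by elim: n => //= n IHn; rewrite size_rcons IHn. Qed.

Lemma nth_bernoulli_seq n k : (k < n)%N -> (bernoulli_seq n)`_k = bernoulli_num k.
Proof.
elim: n => // n IHn; rewrite ltnS leq_eqVlt => /predU1P[-> //|ltkn].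
by rewrite /= nth_rcons size_bernoulli_seq ltkn IHn.
Qed.

Lemma bernoulli_num0 : bernoulli_num 0 = 1.
Proof. by []. Qed.

Lemma bernoulli_num_sum n :
  (0 < n)%N -> \sum_(k < n.+1) 'C(n.+1, k)%:R * bernoulli_num k = 0.
Proof.
move=> n_gt0; rewrite big_ord_recr /= binSn {2}/bernoulli_num /=.
rewrite nth_rcons size_bernoulli_seq ltnn eqxx (gtn_eqF n_gt0).
rewrite mulNr mulrN mulVKf ?pnatr_eq0 //; apply/eqP; rewrite subr_eq0.
by apply/eqP/eq_bigr => k _; rewrite nth_bernoulli_seq.
Qed.

Lemma bernoulli_num1 : bernoulli_num 1 = - 2^-1.
Proof.
by apply/eqP; rewrite /bernoulli_num /= big_ord1.
Qed.

Lemma ncpow_nat (R : realType) (k p : nat) :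
  (0 < k)%N -> ncpow k (p%:R : R[i]) = k%:R ^+ p.
Proof.
move=> k_gt0; have -> : (p%:R : R[i]) = (p%:R)%:C by rewrite rmorph_nat.
rewrite /ncpow -rmorphM /= /cexp /= cos0 sin0 -[1 +i* 0]/((1 : R)%:C) mulr1.
by rewrite expRM_natl lnK ?posrE ?ltr0n // rmorphXn rmorph_nat.
Qed.

Lemma gen_harmonic0 (R : realType) (m : R[i]) : gen_harmonic 0 m = 0.
Proof. by rewrite /gen_harmonic big_geq. Qed.

(* Main.v *)
Require Import Defs.
From mathcomp Require Import all_boot all_order all_algebra.
From mathcomp Require Import reals sequences exp trigo.
From mathcomp Require Import complex.
From mathcomp Require Import ring.

Import Order.TTheory GRing.Theory Num.Theory.
Local Open Scope ring_scope.
Local Open Scope complex_scope.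

(** Faulhaber's formula expands [H_j^(-p)] in powers of [j], so that the last
    sum of the theorem is [\sum_(j <= n) j^(-m) H_j^(-p)]; the identity is then
    summation by parts, carried out by induction on [n].  Faulhaber's formula
    follows from [B_N(x + 1) - B_N(x) = N x^(N-1)] for the Bernoulli polynomials
    at [- x], since [B^+] arises from [B_N] by the substitution [x -> - x]. *)

(** Multiplied by [l! i!], both sides become the falling factorial [N ^_ (l + i)]; this covers
    [l + i > N] as well, where both vanish. *)
Lemma bin_mulC (N l i : nat) :
  ('C(N, l) * 'C(N - l, i) = 'C(N, i) * 'C(N - i, l))%N.
Proof.
have ffactnD a b : (N ^_ (a + b) = N ^_ a * (N - a) ^_ b)%N.
  elim: b => [|b IHb]; first by rewrite addn0 muln1.
  by rewrite addnS !ffactnSr IHb subnDA mulnA.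
have E a b : ('C(N, a) * 'C(N - a, b) * (a`! * b`!) = N ^_ (a + b))%N.
  by rewrite mulnACA !bin_ffact ffactnD.
apply/eqP; rewrite -(eqn_pmul2r (m := l`! * i`!)) ?muln_gt0 ?fact_gt0 //.
by rewrite E (mulnC l`!) E addnC.
Qed.

(** The recurrence with its top term [B_n] included; at [n = 1] the sum is [B_0 + B_1], hence the
    correction. Terms with [l > n] are zero, so the range can be kept independent of [n]. *)
Lemma bernoulli_num_binomial_sum (n N : nat) : (n <= N)%N ->
  \sum_(l < N.+1) 'C(n, l)%:R * bernoulli_num l
    = bernoulli_num n + (n == 1%N)%:R.
Proof.
move=> le_nN.
have -> : \sum_(l < N.+1) 'C(n, l)%:R * bernoulli_num l
    = \sum_(l < n.+1) 'C(n, l)%:R * bernoulli_num l.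
  rewrite [RHS](big_ord_widen N.+1 (fun l => 'C(n, l)%:R * bernoulli_num l)) //.
  rewrite [RHS]big_mkcond; apply: eq_bigr => l _ /=.
  by case: ltnP => // lt_nl; rewrite bin_small ?mul0r.
rewrite big_ord_recr /= binn mul1r addrC; congr (_ + _).
case: n le_nN => [|[|n]] _; first by rewrite big_ord0.
  by rewrite big_ord1 bernoulli_num0 mulr1.
by rewrite bernoulli_num_sum.
Qed.

(** The Bernoulli polynomial [B_N], as a function on the rationals. *)
Definition bernoulli_eval (N : nat) (x : rat) : rat :=
  \sum_(k < N.+1) 'C(N, k)%:R * bernoulli_num (N - k) * x ^+ k.

Lemma bernoulli_evalE (N : nat) (x : rat) :
  bernoulli_eval N x
    = \sum_(l < N.+1) 'C(N, l)%:R * bernoulli_num l * x ^+ (N - l).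
Proof.
rewrite /bernoulli_eval (reindex_inj rev_ord_inj) /=; apply: eq_bigr => l _.
have le_lN : (l <= N)%N by rewrite -ltnS.
by rewrite subSS subKn // bin_sub.
Qed.

(** After binomial expansion and exchange of the sums, the coefficient of [x ^+ i] is ['C(N, i)]
    times the binomial sum of the [B_l] for [N - i]. *)
Lemma bernoulli_eval_shift (p : nat) (x : rat) :
  bernoulli_eval p.+1 (x + 1) = bernoulli_eval p.+1 x + p.+1%:R * x ^+ p.
Proof.
set N := p.+1.
have expand (l : 'I_N.+1) :
    (x + 1) ^+ (N - l) = \sum_(i < N.+1) 'C(N - l, i)%:R * x ^+ i.
  rewrite addrC exprDn.
  rewrite (big_ord_widen N.+1
    (fun i => 1 ^+ (N - l - i) * x ^+ i *+ 'C(N - l, i))) ?ltnS ?leq_subr //.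
  rewrite [LHS]big_mkcond; apply: eq_bigr => i _ /=.
  rewrite ltnS; case: leqP => [_|lt]; first by rewrite expr1n mul1r mulr_natl.
  by rewrite bin_small ?mul0r.
rewrite bernoulli_evalE.
under eq_bigr => l _ do rewrite expand mulr_sumr.
rewrite exchange_big /=.
have inner (i : 'I_N.+1) :
    \sum_(l < N.+1)
      'C(N, l)%:R * bernoulli_num l * ('C(N - l, i)%:R * x ^+ i)
    = 'C(N, i)%:R * bernoulli_num (N - i) * x ^+ i
      + 'C(N, i)%:R * (N - i == 1)%N%:R * x ^+ i.
  rewrite -mulrDl -mulrDr -(bernoulli_num_binomial_sum (N - i) N) ?leq_subr //.
  rewrite mulr_sumr mulr_suml; apply: eq_bigr => l _.
  have := congr1 (fun n : nat => n%:R : rat) (bin_mulC N l i).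
  by rewrite !natrM mulrACA => ->; ring.
under eq_bigr => i _ do rewrite inner.
rewrite big_split /=; congr (_ + _).
(* Of the corrections only the one with [N - i = 1], that is [i = p], survives. *)
rewrite big_ord_recr big_ord_recr /= subnn mulr0 mul0r addr0.
rewrite /N subSnn mulr1 binSn big1 ?add0r // => i _.
have lt_ip := ltn_ord i.
by rewrite subSn 1?ltnW // eqSS subn_eq0 leqNgt lt_ip mulr0 mul0r.
Qed.

(** The right-hand side is [P n - P 0], which telescopes through the difference equation [Pstep]. *)
Lemma faulhaber_rat (p n : nat) :
  p.+1%:R * \sum_(1 <= k < n.+1) k%:R ^+ p
    = \sum_(1 <= k < p.+2)
        'C(p.+1, k)%:R * bernoulli_plus (p.+1 - k) * n%:R ^+ k :> rat.
Proof.
pose P (x : rat) : rat := \sum_(0 <= k < p.+2)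
   'C(p.+1, k)%:R * bernoulli_plus (p.+1 - k) * x ^+ k.
have PE x : P x = (-1) ^+ p.+1 * bernoulli_eval p.+1 (- x).
  rewrite /P big_mkord /bernoulli_eval mulr_sumr; apply: eq_bigr => k _.
  have le_kp : (k <= p.+1)%N by rewrite -ltnS.
  have -> : (-1) ^+ p.+1 = (-1) ^+ (p.+1 - k) * (-1) ^+ k :> rat.
    by rewrite -exprD subnK.
  rewrite /bernoulli_plus (exprNn x).
  by have := sqrr_sign rat k; rewrite expr2 => E; ring: E.
(* The shift is taken at [- (x + 1)], so it leads from [P (x + 1)] back to [P x]; the signs
   [(-1) ^+ p] cancel. *)
have Pstep x : P (x + 1) = P x + p.+1%:R * (x + 1) ^+ p.
  have := bernoulli_eval_shift p (- (x + 1)); rewrite opprD subrK -opprD => E.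
  rewrite !PE E mulrDr (exprNn (x + 1)) exprS.
  by have := sqrr_sign rat p; rewrite expr2 => E2; ring: E2.
have PS k : P k%:R = P 0 + p.+1%:R * \sum_(1 <= i < k.+1) i%:R ^+ p.
  elim: k => [|k IHk]; first by rewrite big_geq // mulr0 addr0.
  by rewrite -natr1 Pstep IHk [in RHS]big_nat_recr //= mulrDr addrA natr1.
have Psplit x : P x = P 0 + \sum_(1 <= k < p.+2)
    'C(p.+1, k)%:R * bernoulli_plus (p.+1 - k) * x ^+ k.
  have tail0 : \sum_(1 <= k < p.+2)
      'C(p.+1, k)%:R * bernoulli_plus (p.+1 - k) * 0 ^+ k = 0 :> rat.
    rewrite big_nat big1 // => k /andP[k_gt0 _].
    by rewrite expr0n eqn0Ngt k_gt0 mulr0.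
  by rewrite /P !(big_ltn (ltn0Sn p.+1)) tail0 !expr0 addr0.
by apply: (addrI (P 0)); rewrite -PS Psplit.
Qed.

Lemma faulhaber (F : numFieldType) (p n : nat) :
  \sum_(1 <= k < n.+1) k%:R ^+ p
    = p.+1%:R^-1 * \sum_(1 <= k < p.+2)
        'C(p.+1, k)%:R * ratr (bernoulli_plus (p.+1 - k)) * n%:R ^+ k :> F.
Proof.
apply: (mulfI (x := p.+1%:R)); first by rewrite pnatr_eq0.
rewrite mulVKf ?pnatr_eq0 //.
have := congr1 (@ratr F) (faulhaber_rat p n).
rewrite rmorphM rmorph_nat !rmorph_sum /=.
under eq_bigr => k _ do rewrite rmorphXn rmorph_nat.
move=> ->; apply: eq_bigr => k _.
by rewrite rmorphM rmorphXn /= rmorph_nat rmorphM rmorph_nat.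
Qed.

Lemma cexpD (R : realType) (z w : R[i]) : cexp (z + w) = cexp z * cexp w.
Proof.
case: z w => [a b] [c d]; rewrite /cexp /= expRD cosD sinD rmorphM /=.
by rewrite mulrACA; congr (_ * _); simpc; rewrite [X in _ +i* X]addrC.
Qed.

Lemma ncpowD (R : realType) (k : nat) (m l : R[i]) :
  ncpow k (m + l) = ncpow k m * ncpow k l.
Proof. by rewrite /ncpow mulrDl cexpD. Qed.

(** Lowering the exponent by [p] multiplies a harmonic term by [k ^+ p]; this is how Faulhaber's
    powers meet the shifted harmonic numbers. *)
Lemma ncpowB_nat_inv (R : realType) (k p : nat) (m : R[i]) : (0 < k)%N ->
  (ncpow k (m - p%:R))^-1 = (ncpow k m)^-1 * k%:R ^+ p.
Proof.
move=> k_gt0.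
rewrite -{2}[m](subrK p%:R) (ncpowD _ _ (m - _)) ncpow_nat //.
rewrite [RHS]mulrC (invfM (ncpow _ _)) mulrCA divff ?mulr1 //.
by rewrite expf_neq0 // pnatr_eq0 -lt0n.
Qed.

Lemma ncpowN_nat_inv (R : realType) (k p : nat) : (0 < k)%N ->
  (ncpow k (- p%:R : R[i]))^-1 = k%:R ^+ p.
Proof.
move=> k_gt0; rewrite -[- _]add0r ncpowB_nat_inv // -[0]/(0%:R) ncpow_nat //.
by rewrite expr0 invr1 mul1r.
Qed.

Lemma gen_harmonicS (R : realType) (n : nat) (m : R[i]) :
  gen_harmonic n.+1 m = gen_harmonic n m + (ncpow n.+1 m)^-1.
Proof. by rewrite /gen_harmonic big_nat_recr. Qed.

Lemma gen_harmonicN_nat (R : realType) (n p : nat) :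
  gen_harmonic n (- p%:R : R[i]) = \sum_(1 <= k < n.+1) k%:R ^+ p.
Proof.
rewrite /gen_harmonic !big_nat; apply: eq_bigr => k /andP[k_gt0 _].
by rewrite ncpowN_nat_inv.
Qed.

Theorem theorem3p2 (R : realType) (n p : nat) (m : R[i]) :
  \sum_(0 <= k < n.+1) k%:R ^+ p * gen_harmonic k m =
    gen_harmonic n (- p%:R) * gen_harmonic n m + gen_harmonic n (m - p%:R)
    - (p.+1%:R)^-1 *
      \sum_(1 <= k < p.+2)
        'C(p.+1, k)%:R * ratr (bernoulli_plus (p.+1 - k)) *
        gen_harmonic n (m - k%:R).
Proof.
elim: n => [|n IHn].
  rewrite big_nat1 !gen_harmonic0 !mulr0 addr0 big1 ?mulr0 ?subr0 // => k _.
  by rewrite gen_harmonic0 mulr0.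
(* The increment of the Bernoulli sum is [(n+1)^(-m)] times Faulhaber's expression at [n+1]. *)
have bern_sumS : (p.+1%:R)^-1 * \sum_(1 <= k < p.+2)
      'C(p.+1, k)%:R * ratr (bernoulli_plus (p.+1 - k)) *
      gen_harmonic n.+1 (m - k%:R)
    = (p.+1%:R)^-1 * \sum_(1 <= k < p.+2)
        'C(p.+1, k)%:R * ratr (bernoulli_plus (p.+1 - k)) *
        gen_harmonic n (m - k%:R)
      + gen_harmonic n.+1 (- p%:R) * (ncpow n.+1 m)^-1.
  rewrite gen_harmonicN_nat faulhaber -mulrA -mulrDr mulr_suml -big_split /=.
  congr (_ * _); apply: eq_bigr => k _.
  by rewrite gen_harmonicS ncpowB_nat_inv //; ring.
(* With [a = (n+1)^p], [b = (n+1)^(-m)], [S = H_n^(-p)] and [H = H_n^(m)], it remains that [a (H +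
   b) = (S + a)(H + b) - S H + a b - (S + a) b]. *)
rewrite big_nat_recr //= IHn bern_sumS !gen_harmonicS.
rewrite (ncpowB_nat_inv _ n.+1) // (ncpowN_nat_inv _ n.+1) //.
by ring.
Qed.
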